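(* Let $\mathcal T$ be a reduced T-mesh, $\mathbf r$ a smoothness distribution on $\mathcal T$ that is constant along each maximal segment, $m,m'\ge0$ integers, and $\mathcal C:=\operatorname{CNDC}_{m,m'}^{\mathbf r}(\mathcal T)$. For a total order $\widehat\iota$ of $\operatorname{MIS}(\mathcal T)$ let $$U_{\mathrm{all}}(\widehat\iota):=\sum_{\rho\in\operatorname{MIS}_h(\mathcal T)}\bigl(m+1-\omega_{\widehat\iota}(\rho)\bigr)_+\beta^{\mathbf r}(\rho)+\sum_{\rho\in\operatorname{MIS}_v(\mathcal T)}\bigl(m'+1-\omega_{\widehat\iota}(\rho)\bigr)_+\beta^{\mathbf r}(\rho),$$ $$U_{\mathrm{CNDC}}(\widehat\iota):=\sum_{\rho\in\mathcal C\cap\operatorname{MIS}_h(\mathcal T)}\bigl(m+1-\omega_{\widehat\iota}(\rho)\bigr)_+\beta^{\mathbf r}(\rho)+\sum_{\rho\in\mathcal C\cap\operatorname{MIS}_v(\mathcal T)}\bigl(m'+1-\omega_{\widehat\iota}(\rho)\bigr)_+\beta^{\mathbf r}(\rho).$$ Then for every total order $\widehat\iota$ that follows the reversed deletion history, $$U_{\mathrm{CNDC}}(\widehat\iota)=U_{\mathrm{all}}(\widehat\iota).$$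
   Context: **T-meshes.** Coordinates on $\mathbb R^2$ are $(s,t)$, with $s$ horizontal and $t$ vertical. Let $\Omega\subset\mathbb R^2$ be a finite union of closed axis-aligned rectangles with pairwise disjoint interiors, with $\Omega$ simply connected and $\Omega^\circ$ connected. A T-mesh on $\Omega$ is a triple $\mathcal T=(\mathcal T_2,\mathcal T_1,\mathcal T_0)$: $\mathcal T_2$ is the finite set of these closed rectangles (cells); $\mathcal T_1=\mathcal T_1^h\cup\mathcal T_1^v$ is a finite set of closed horizontal and vertical segments (edges) contained in $\bigcup_{\sigma\in\mathcal T_2}\partial\sigma$; $\mathcal T_0$ is the set of endpoints of edges (vertices); each $\partial\sigma$ is a finite union of edges; distinct cells $\sigma,\sigma'$ satisfy $\sigma\cap\sigma'=\partial\sigma\cap\partial\sigma'$, a finite union of edges and vertices; distinct edges meet only in vertices. Interior edges $\mathcal T_1^\circ$ are the edges meeting $\Omega^\circ$; the other edges are boundary edges. Interior vertices $\mathcal T_0^\circ$ are the vertices in $\Omega^\circ$. **Maximal segments.** A segment is a connected union of edges lying on one straight line. $\operatorname{MS}(\mathcal T)$ is the set of maximal segments consisting of interior edges. Such a segment is a cross-cut if both endpoints lie on $\partial\Omega$, a ray if exactly one does, and a maximal interior segment (MIS) if it does not meet $\partial\Omega$; $\operatorname{MIS}(\mathcal T)=\operatorname{MIS}_h(\mathcal T)\cup\operatorname{MIS}_v(\mathcal T)$ (horizontal/vertical). A boundary maximal segment is a maximal connected union of boundary edges on one line. $\widehat{\operatorname{MS}}(\mathcal T)$ is the set of all cross-cuts,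 rays, MISs and boundary maximal segments. $\mathcal T$ is reduced if no vertex is inserted merely to divide a straight edge into two collinear edges, every vertex lies on exactly one horizontal and exactly one vertical member of $\widehat{\operatorname{MS}}(\mathcal T)$, and the edges are exactly the closed subsegments between consecutive vertices on these members (so an interior and a boundary maximal segment of the same direction never meet collinearly at a common endpoint). **Smoothness.** A smoothness distribution is a map $\mathbf r:\mathcal T_1\to\{-1,0,1,\dots\}$ equal to $-1$ on boundary edges. It is constant along each maximal segment if for every $\rho\in\operatorname{MS}(\mathcal T)$ all edges $\tau\subset\rho$ have the same value $\mathbf r(\tau)=:r(\rho)$. For $\gamma\in\mathcal T_0^\circ$ with horizontal and vertical maximal segments $\rho_h(\gamma),\rho_v(\gamma)$ through it, $r_h(\gamma):=r(\rho_v(\gamma))$ and $r_v(\gamma):=r(\rho_h(\gamma))$. **Weights.** $(a)_+=\max\{a,0\}$, $\mu_h(\gamma)=(m-r_h(\gamma))_+$, $\mu_v(\gamma)=(m'-r_v(\gamma))_+$. For a total order $\iota:\rho_1\succ\cdots\succ\rho_t$ of $\operatorname{MIS}(\mathcal T)$, $\Gamma_\iota(\rho_i)$ is the set of vertices $\gamma$ on $\rho_i$ with $\gamma\notin\rho_j$ for all $j<i$; the relative weight $\omega_\iota(\rho_i)$ is $\sum_{\gamma\in\Gamma_\iota(\rho_i)}\mu_h(\gamma)$ for $\rho_i$ horizontal, $\sum_{\gamma\in\Gamma_\iota(\rho_i)}\mu_v(\gamma)$ for $\rho_i$ vertical. A deletion state is a pair $(\mathcal A,\mathcal B)$ with $\mathcal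 A\cap\mathcal B=\varnothing$, $\mathcal A\cup\mathcal B=\operatorname{MIS}(\mathcal T)$. For $\rho\in\mathcal A$, $\operatorname{Mono}_{(\mathcal A,\mathcal B)}(\rho)$ is the set of vertices on $\rho$ lying on no MIS in $\mathcal A\setminus\{\rho\}$; the absolute weight $\Omega_{(\mathcal A,\mathcal B)}(\rho)$ is the sum over $\operatorname{Mono}_{(\mathcal A,\mathcal B)}(\rho)$ of $\mu_h(\gamma)$ for $\rho$ horizontal, of $\mu_v(\gamma)$ for $\rho$ vertical. The threshold is $\theta(\rho)=m+1$ for $\rho$ horizontal, $m'+1$ for $\rho$ vertical. $\rho\in\mathcal A$ is diagonalizable at $(\mathcal A,\mathcal B)$ if $\Omega_{(\mathcal A,\mathcal B)}(\rho)\ge\theta(\rho)$. Finally $\beta^{\mathbf r}(\rho)=(m'-r(\rho))_+$ for $\rho$ a horizontal MIS and $\beta^{\mathbf r}(\rho)=(m-r(\rho))_+$ for $\rho$ a vertical MIS. **Deletion algorithm, weighted CNDC, reversed deletion history.** Start with $\mathcal A=\operatorname{MIS}(\mathcal T)$, $\mathcal B=\varnothing$. In each pass let $\mathcal Z$ be the set of all $\rho\in\mathcal A$ diagonalizable at $(\mathcal A,\mathcal B)$, and replace $\mathcal A$ by $\mathcal A\setminus\mathcal Z$ and $\mathcal B$ by $\mathcal B\cup\mathcal Z$; repeat until a pass has $\mathcal Z=\varnothing$. The final $\mathcal A$ is the weighted CNDC $\operatorname{CNDC}_{m,m'}^{\mathbf r}(\mathcal T)$. Let $\mathcal Z_1,\dots,\mathcal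 Z_N$ be the nonempty sets removed in the successive passes. A total order $\widehat\iota$ (written from $\succ$-largest, listed first, to smallest) of $\operatorname{MIS}(\mathcal T)$ follows the reversed deletion history if it lists first the MISs in $\mathcal Z_N$, then those in $\mathcal Z_{N-1}$, and so on down to $\mathcal Z_1$, and finally those in $\operatorname{CNDC}_{m,m'}^{\mathbf r}(\mathcal T)$, with arbitrary order within each $\mathcal Z_k$ and within the CNDC. *)

(* Defs.v *)
From HB Require Import structures.
From mathcomp Require Import all_boot all_order all_algebra.
From mathcomp Require Import finmap.
From mathcomp Require Import all_classical all_reals all_analysis.

Set Implicit Arguments.
Unset Strict Implicit.
Unset Printing Implicit Defensive.

Import Order.TTheory GRing.Theory Num.Theory.
Import numFieldNormedType.Exports.

Local Open Scope classical_set_scope.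
Local Open Scope ring_scope.

(* A point of the plane is a pair (s, t), s horizontal and t vertical.  Cells,
   edges and segments are sets of points, so that equality of such objects is
   equality of point sets. *)
Notation plane R := (R * R)%type.

Definition box (R : realType) (p q : plane R) : set (plane R) :=
  [set x | p.1 <= x.1 <= q.1 /\ p.2 <= x.2 <= q.2].

Definition is_rectangle (R : realType) (S : set (plane R)) : Prop :=
  exists p q : plane R, [/\ p.1 < q.1, p.2 < q.2 & S = box p q].

Definition hsegment (R : realType) (p q : plane R) (S : set (plane R)) : Prop :=
  [/\ p.1 < q.1, p.2 = q.2 & S = box p q].

Definition vsegment (R : realType) (p q : plane R) (S : set (plane R)) : Prop :=
  [/\ p.1 = q.1, p.2 < q.2 & S = box p q].

Definition segment_between (R : realType) (p q : plane R) (S : set (plane R)) :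
  Prop := hsegment p q S \/ vsegment p q S.

Definition horizontal (R : realType) (S : set (plane R)) : Prop :=
  exists p q : plane R, hsegment p q S.

Definition vertical (R : realType) (S : set (plane R)) : Prop :=
  exists p q : plane R, vsegment p q S.

Definition endpoints (R : realType) (S : set (plane R)) : set (plane R) :=
  [set x | exists p q : plane R, segment_between p q S /\ (x = p \/ x = q)].

Definition frontier (R : realType) (S : set (plane R)) : set (plane R) :=
  closure S `\` interior S.

Definition on_axis_line (R : realType) (S : set (plane R)) : Prop :=
  (exists c : R, S `<=` [set x | x.2 = c]) \/
  (exists c : R, S `<=` [set x | x.1 = c]).

Definition path_in (R : realType) (D : set (plane R)) (f : R -> plane R) :
  Prop :=
  {within `[0, 1], continuous f} /\ f @` `[0, 1] `<=` D.

Definition loop_contractible (R : realType) (D : set (plane R))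
    (f : R -> plane R) : Prop :=
  exists H : plane R -> plane R,
    [/\ {within box (0, 0) (1, 1), continuous H},
        H @` box (0, 0) (1, 1) `<=` D,
        forall u : R, 0 <= u <= 1 -> H (0, u) = f u,
        forall u : R, 0 <= u <= 1 -> H (1, u) = f 0 &
        forall v : R, 0 <= v <= 1 -> H (v, 0) = f 0 /\ H (v, 1) = f 0].

Definition simply_connected (R : realType) (D : set (plane R)) : Prop :=
  (forall x y : plane R, D x -> D y ->
     exists f : R -> plane R, [/\ path_in D f, f 0 = x & f 1 = y]) /\
  (forall f : R -> plane R, path_in D f -> f 0 = f 1 -> loop_contractible D f).

(* The vertices are determined by the edges and hence are not a field. *)
Record mesh (R : realType) := Mesh {
  cells : set (set (plane R));
  edges : set (set (plane R))
}.

Definition vertices (R : realType) (T : mesh R) : set (plane R) :=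
  \bigcup_(e in edges T) endpoints e.

Definition domain (R : realType) (T : mesh R) : set (plane R) :=
  \bigcup_(c in cells T) c.

Record is_tmesh (R : realType) (T : mesh R) : Prop := IsTMesh {
  cells_finite : finite_set (cells T);
  cells_rectangle : forall c, cells T c -> is_rectangle c;
  cells_interior_disjoint : forall c c', cells T c -> cells T c' -> c <> c' ->
    interior c `&` interior c' = set0;
  domain_simply_connected : simply_connected (domain T);
  domain_interior_connected : connected (interior (domain T));
  edges_finite : finite_set (edges T);
  edges_axis_parallel : forall e, edges T e -> horizontal e \/ vertical e;
  edges_in_frontiers : forall e, edges T e ->
    e `<=` \bigcup_(c in cells T) frontier c;
  cell_frontier : forall c, cells T c ->
    exists2 F : set (set (plane R)), F `<=` edges T &
      frontier c = \bigcup_(e in F) e;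
  cells_meet : forall c c', cells T c -> cells T c' -> c <> c' ->
    c `&` c' = frontier c `&` frontier c' /\
    exists F : set (set (plane R)), exists V : set (plane R),
      [/\ F `<=` edges T, V `<=` vertices T &
          c `&` c' = (\bigcup_(e in F) e) `|` V];
  edges_meet : forall e e', edges T e -> edges T e' -> e <> e' ->
    e `&` e' `<=` vertices T
}.

Definition interior_edges (R : realType) (T : mesh R) : set (set (plane R)) :=
  [set e | edges T e /\ e `&` interior (domain T) !=set0].

Definition boundary_edges (R : realType) (T : mesh R) : set (set (plane R)) :=
  edges T `\` interior_edges T.

Definition is_segment (R : realType) (E : set (set (plane R)))
    (S : set (plane R)) : Prop :=
  [/\ exists F : set (set (plane R)),
        [/\ F !=set0, F `<=` E & S = \bigcup_(e in F) e],
      connected S & on_axis_line S].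

Definition maximal_segments (R : realType) (E : set (set (plane R))) :
  set (set (plane R)) :=
  [set S | is_segment E S /\
           forall S', is_segment E S' -> S `<=` S' -> S' = S].

Definition MS (R : realType) (T : mesh R) : set (set (plane R)) :=
  maximal_segments (interior_edges T).

Definition boundary_MS (R : realType) (T : mesh R) : set (set (plane R)) :=
  maximal_segments (boundary_edges T).

Definition cross_cuts (R : realType) (T : mesh R) : set (set (plane R)) :=
  [set rho | MS T rho /\ endpoints rho `<=` frontier (domain T)].

Definition rays (R : realType) (T : mesh R) : set (set (plane R)) :=
  [set rho | MS T rho /\
             exists! x, endpoints rho x /\ frontier (domain T) x].

Definition MIS (R : realType) (T : mesh R) : set (set (plane R)) :=
  [set rho | MS T rho /\ rho `&` frontier (domain T) = set0].

Definition MIS_h (R : realType) (T : mesh R) : set (set (plane R)) :=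
  [set rho | MIS T rho /\ horizontal rho].

Definition MIS_v (R : realType) (T : mesh R) : set (set (plane R)) :=
  [set rho | MIS T rho /\ vertical rho].

Definition MS_hat (R : realType) (T : mesh R) : set (set (plane R)) :=
  cross_cuts T `|` rays T `|` MIS T `|` boundary_MS T.

(* A vertex merely divides a straight edge when the edges containing it are
   exactly two edges, of the same direction. *)
Definition merely_divides (R : realType) (T : mesh R) (x : plane R) : Prop :=
  exists e e' : set (plane R),
    [/\ e <> e',
        (horizontal e /\ horizontal e') \/ (vertical e /\ vertical e') &
        [set d | edges T d /\ d x] = [set e; e']].

Record reduced (R : realType) (T : mesh R) : Prop := Reduced {
  no_dividing_vertex : forall x, vertices T x -> ~ merely_divides T x;
  one_horizontal : forall x, vertices T x ->
    exists! rho, [/\ MS_hat T rho, horizontal rho & rho x];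
  one_vertical : forall x, vertices T x ->
    exists! rho, [/\ MS_hat T rho, vertical rho & rho x];
  edges_consecutive : forall e, edges T e <->
    exists rho, exists p q : plane R,
      [/\ MS_hat T rho, segment_between p q e, e `<=` rho &
          vertices T `&` e = [set p; q]]
}.

(* Smoothness distributions are total functions on point sets; only their
   values on edges matter. *)
Definition smoothness_distribution (R : realType) (T : mesh R)
    (r : set (plane R) -> int) : Prop :=
  (forall e, edges T e -> -1 <= r e) /\
  (forall e, boundary_edges T e -> r e = -1).

Definition constant_along_MS (R : realType) (T : mesh R)
    (r : set (plane R) -> int) : Prop :=
  forall rho, MS T rho -> forall e e', edges T e -> edges T e' ->
    e `<=` rho -> e' `<=` rho -> r e = r e'.

(* The common value of r on the edges contained in rho. *)
Definition smooth (R : realType) (T : mesh R) (r : set (plane R) -> int)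
    (rho : set (plane R)) : int :=
  r (xget set0 [set e | edges T e /\ e `<=` rho]).

(* The horizontal and the vertical maximal segment through x; in a reduced
   T-mesh they exist and are unique when x is an interior vertex. *)
Definition MS_h_at (R : realType) (T : mesh R) (x : plane R) : set (plane R) :=
  xget set0 [set rho | [/\ MS T rho, horizontal rho & rho x]].

Definition MS_v_at (R : realType) (T : mesh R) (x : plane R) : set (plane R) :=
  xget set0 [set rho | [/\ MS T rho, vertical rho & rho x]].

Definition r_h (R : realType) (T : mesh R) (r : set (plane R) -> int)
  (x : plane R) : int := smooth T r (MS_v_at T x).

Definition r_v (R : realType) (T : mesh R) (r : set (plane R) -> int)
  (x : plane R) : int := smooth T r (MS_h_at T x).

Definition pos_part (a : int) : int := Num.max a 0.

Definition mu_h (R : realType) (T : mesh R) (r : set (plane R) -> int)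
  (m : nat) (x : plane R) : int := pos_part (m%:Z - r_h T r x).

Definition mu_v (R : realType) (T : mesh R) (r : set (plane R) -> int)
  (m' : nat) (x : plane R) : int := pos_part (m'%:Z - r_v T r x).

Definition mu_along (R : realType) (T : mesh R) (r : set (plane R) -> int)
    (m m' : nat) (rho : set (plane R)) (x : plane R) : int :=
  if `[< horizontal rho >] then mu_h T r m x else mu_v T r m' x.

Definition theta (R : realType) (m m' : nat) (rho : set (plane R)) : int :=
  if `[< horizontal rho >] then m.+1%:Z else m'.+1%:Z.

Definition beta (R : realType) (T : mesh R) (r : set (plane R) -> int)
    (m m' : nat) (rho : set (plane R)) : int :=
  if `[< horizontal rho >] then pos_part (m'%:Z - smooth T r rho)
  else pos_part (m%:Z - smooth T r rho).

(* A total order on MIS T, listed from the largest element to the smallest. *)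
Definition MIS_order (R : realType) (T : mesh R)
    (iota : seq (set (plane R))) : Prop :=
  uniq iota /\ [set` iota] = MIS T.

Definition Gamma (R : realType) (T : mesh R) (iota : seq (set (plane R)))
    (rho : set (plane R)) : set (plane R) :=
  [set x | [/\ vertices T x, rho x &
     forall j, (j < index rho iota)%N -> ~ (nth set0 iota j) x]].

Definition omega (R : realType) (T : mesh R) (r : set (plane R) -> int)
    (m m' : nat) (iota : seq (set (plane R))) (rho : set (plane R)) : int :=
  \sum_(x \in Gamma T iota rho) mu_along T r m m' rho x.

Notation deletion_state R := (set (set (plane R)) * set (set (plane R)))%type.

Definition Mono (R : realType) (T : mesh R) (st : deletion_state R)
    (rho : set (plane R)) : set (plane R) :=
  [set x | [/\ vertices T x, rho x &
     forall rho', (st.1 `\ rho) rho' -> ~ rho' x]].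

Definition Omega (R : realType) (T : mesh R) (r : set (plane R) -> int)
    (m m' : nat) (st : deletion_state R) (rho : set (plane R)) : int :=
  \sum_(x \in Mono T st rho) mu_along T r m m' rho x.

Definition diagonalizable_set (R : realType) (T : mesh R)
    (r : set (plane R) -> int) (m m' : nat) (st : deletion_state R) :
  set (set (plane R)) :=
  [set rho | st.1 rho /\ theta m m' rho <= Omega T r m m' st rho].

Definition deletion_pass (R : realType) (T : mesh R)
    (r : set (plane R) -> int) (m m' : nat) (st : deletion_state R) :
  deletion_state R :=
  let Z := diagonalizable_set T r m m' st in (st.1 `\` Z, st.2 `|` Z).

Definition state_after (R : realType) (T : mesh R)
    (r : set (plane R) -> int) (m m' k : nat) : deletion_state R :=
  iter k (deletion_pass T r m m') (MIS T, set0).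

(* removed k is the set removed in pass k, passes being counted from 0. *)
Definition removed (R : realType) (T : mesh R) (r : set (plane R) -> int)
    (m m' k : nat) : set (set (plane R)) :=
  diagonalizable_set T r m m' (state_after T r m m' k).

Definition first_idle_pass (R : realType) (T : mesh R)
    (r : set (plane R) -> int) (m m' N : nat) : Prop :=
  removed T r m m' N = set0 /\
  forall k, (k < N)%N -> removed T r m m' k !=set0.

(* The number of effective passes.  It is well defined for a T-mesh:
   see deletion_terminates and first_idle_pass_unique. *)
Definition pass_count (R : realType) (T : mesh R) (r : set (plane R) -> int)
    (m m' : nat) : nat :=
  xget 0%N [set N | first_idle_pass T r m m' N].

Definition CNDC (R : realType) (T : mesh R) (r : set (plane R) -> int)
    (m m' : nat) : set (set (plane R)) :=
  (state_after T r m m' (pass_count T r m m')).1.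

(* The sequence Z_1, ..., Z_N. *)
Definition deletion_history (R : realType) (T : mesh R)
    (r : set (plane R) -> int) (m m' : nat) : seq (set (set (plane R))) :=
  mkseq (removed T r m m') (pass_count T r m m').

(* iota is a concatenation of lists whose sets of elements are successively
   Z_N, ..., Z_1 and the CNDC. *)
Definition follows_reversed_history (R : realType) (T : mesh R)
    (r : set (plane R) -> int) (m m' : nat) (iota : seq (set (plane R))) :
  Prop :=
  exists2 blocks : seq (seq (set (plane R))), iota = flatten blocks &
    [seq [set` b] | b <- blocks] =
      rcons (rev (deletion_history T r m m')) (CNDC T r m m').

Definition U_all (R : realType) (T : mesh R) (r : set (plane R) -> int)
    (m m' : nat) (iota : seq (set (plane R))) : int :=
  \sum_(rho \in MIS_h T)
     pos_part (m.+1%:Z - omega T r m m' iota rho) * beta T r m m' rho +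
  \sum_(rho \in MIS_v T)
     pos_part (m'.+1%:Z - omega T r m m' iota rho) * beta T r m m' rho.

Definition U_CNDC (R : realType) (T : mesh R) (r : set (plane R) -> int)
    (m m' : nat) (iota : seq (set (plane R))) : int :=
  \sum_(rho \in CNDC T r m m' `&` MIS_h T)
     pos_part (m.+1%:Z - omega T r m m' iota rho) * beta T r m m' rho +
  \sum_(rho \in CNDC T r m m' `&` MIS_v T)
     pos_part (m'.+1%:Z - omega T r m m' iota rho) * beta T r m m' rho.

Lemma first_idle_pass_unique (R : realType) (T : mesh R)
    (r : set (plane R) -> int) (m m' N N' : nat) :
  first_idle_pass T r m m' N -> first_idle_pass T r m m' N' -> N = N'.
Proof.
move=> [ZN minN] [ZN' minN']; case: (ltngtP N N') => // lt.
  by have := minN' _ lt; rewrite ZN => -[].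
by have := minN _ lt; rewrite ZN' => -[].
Qed.

Lemma MIS_finite (R : realType) (T : mesh R) :
  is_tmesh T -> finite_set (MIS T).
Proof.
move=> hT; have fE := edges_finite hT.
have fP : finite_set [set F | F `<=` edges T].
  pose E := fset_set (edges T).
  apply: (sub_finite_set _ (finite_image (fun X => [set` X])
    (finite_fset (fpowerset E)))) => F /= FE.
  have fF : finite_set F by exact: sub_finite_set FE fE.
  exists (fset_set F); last by rewrite fset_setK.
  by rewrite /= fpowersetE -fset_set_sub.
apply: (sub_finite_set _ (finite_image (fun F => \bigcup_(e in F) e) fP)).
move=> rho [[[[F [_ FE ->]] _ _] _] _]; exists F => //=.
by move=> e /FE[].
Qed.

Lemma deletion_terminates (R : realType) (T : mesh R)
    (r : set (plane R) -> int) (m m' : nat) :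
  is_tmesh T -> exists N, first_idle_pass T r m m' N.
Proof.
move=> hT; set st := state_after T r m m'; set Z := removed T r m m'.
have stS k : (st k.+1).1 = (st k).1 `\` Z k by [].
have fin k : finite_set (st k).1.
  elim: k => [|k IHk]; first exact: MIS_finite.
  by rewrite stS; apply: finite_setD.
suff [k Zk] : exists k, Z k == set0.
  have ex : exists k, Z k == set0 by exists k.
  exists (ex_minn ex); case: ex_minnP => N /eqP ZN minN; split=> // j ltjN.
  by apply/set0P/negP => /minN; rewrite leqNgt ltjN.
apply: contrapT => /forallNP Zn.
have card k : (#|` fset_set (st k).1| + k <= #|` fset_set (st 0%N).1|)%N.
  elim: k => [|k IHk]; first by rewrite addn0.
  apply: leq_trans IHk; rewrite addnS -addSn leq_add2r.
  apply: fproper_ltn_card; rewrite fproperE; apply/andP; split.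
    rewrite -fset_set_sub //.
    by rewrite stS; exact: subDsetl.
  have /negP/set0P[rho Zrho] := Zn k.
  apply/negP => /fsubsetP /(_ rho); rewrite !in_fset_set // !inE.
  by move=> /(_ (proj1 Zrho)) [].
by have := card (#|` fset_set (st 0%N).1|).+1; rewrite addnS ltnNge leq_addl.
Qed.

(* Main.v *)
Require Import Defs.
From mathcomp Require Import all_boot all_order all_algebra.
From mathcomp Require Import all_classical all_reals all_analysis.

(** An MIS rho outside the CNDC is removed in some pass k.  Whatever precedes
    rho in a reversed deletion history is removed in a pass at least k, hence
    is still present at pass k.  So every vertex counted in the absolute weight
    of rho at pass k is also counted in its relative weight, which therefore
    reaches the threshold, and the term of rho in [U_all] vanishes. *)

Set Implicit Arguments.
Unset Strict Implicit.
Unset Printing Implicit Defensive.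

Import Order.TTheory GRing.Theory Num.Theory.

Local Open Scope classical_set_scope.
Local Open Scope ring_scope.

(** A nonempty box contains its two corners, so testing each corner against the other box gives the
    inequalities in both directions. Non-strict bounds let this cover segments, which are degenerate
    boxes. *)
Lemma box_inj (R : realType) (p q p' q' : plane R) :
  p.1 <= q.1 -> p.2 <= q.2 -> p'.1 <= q'.1 -> p'.2 <= q'.2 ->
  box p q = box p' q' -> p = p' /\ q = q'.
Proof.
move=> pq1 pq2 pq1' pq2' E.
have /= [/andP[a1 _] /andP[a2 _]] : box p' q' p.
  by rewrite -E /box /= !lexx pq1 pq2.
have /= [/andP[_ b1] /andP[_ b2]] : box p' q' q.
  by rewrite -E /box /= !lexx pq1 pq2.
have /= [/andP[c1 _] /andP[c2 _]] : box p q p'.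
  by rewrite E /box /= !lexx pq1' pq2'.
have /= [/andP[_ d1] /andP[_ d2]] : box p q q'.
  by rewrite E /box /= !lexx pq1' pq2'.
rewrite (surjective_pairing p) (surjective_pairing q).
rewrite (surjective_pairing p') (surjective_pairing q').
by split; congr pair; apply/eqP; rewrite eq_le; apply/andP.
Qed.

Lemma segment_between_box (R : realType) (p q : plane R) (S : set (plane R)) :
  segment_between p q S -> [/\ p.1 <= q.1, p.2 <= q.2 & S = box p q].
Proof.
by case=> -[h1 h2 ->]; split=> //; rewrite ?h1 ?h2 //; exact: ltW.
Qed.

Lemma segment_between_inj (R : realType) (p q p' q' : plane R)
    (S : set (plane R)) :
  segment_between p q S -> segment_between p' q' S -> p = p' /\ q = q'.
Proof.
move=> /segment_between_box[h1 h2 ->] /segment_between_box[h1' h2'].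
exact: box_inj.
Qed.

(** Thresholds and weights choose their direction by testing [horizontal]; this sends a vertical MIS
    to the other branch. *)
Lemma vertical_not_horizontal (R : realType) (S : set (plane R)) :
  vertical S -> ~ horizontal S.
Proof.
move=> [p [q v]] [p' [q' h]].
have [pp' qq'] := segment_between_inj (or_intror v) (or_introl h).
by case: v h => [e _ _] [+ _ _]; rewrite -pp' -qq' e ltxx.
Qed.

Lemma endpoints_finite (R : realType) (S : set (plane R)) :
  finite_set (endpoints S).
Proof.
have [[p [q pq]]|no] := pselect (exists p q, segment_between p q S).
  apply: (@sub_finite_set _ _ [set p; q]); last exact: finite_set2.
  move=> x [p' [q' [pq' xE]]].
  by have [-> ->] := segment_between_inj pq pq'.
rewrite (_ : endpoints S = set0) // -subset0 => x [p [q [pq _]]].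
by apply: no; exists p, q.
Qed.

Lemma vertices_finite (R : realType) (T : mesh R) :
  is_tmesh T -> finite_set (vertices T).
Proof.
move=> hT; apply: bigcup_finite; first exact: edges_finite hT.
by move=> e _; exact: endpoints_finite.
Qed.

Lemma pos_part_ge0 (a : int) : 0 <= pos_part a.
Proof. by rewrite /pos_part le_max lexx orbT. Qed.

Lemma pos_part_eq0 (a : int) : a <= 0 -> pos_part a = 0.
Proof. by move=> a0; rewrite /pos_part max_r. Qed.

Section DeletionHistory.
Context (R : realType) (T : mesh R) (r : set (plane R) -> int) (m m' : nat).

Local Notation A k := (state_after T r m m' k).1.
Local Notation Z k := (removed T r m m' k).

Lemma mu_along_ge0 (rho : set (plane R)) (x : plane R) :
  0 <= mu_along T r m m' rho x.
Proof. by rewrite /mu_along; case: ifP => _; exact: pos_part_ge0. Qed.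

Lemma state_after_subset (k l : nat) : (k <= l)%N -> A l `<=` A k.
Proof.
move=> /subnK <-; elim: (l - k)%N => [//|n IHn] rho.
by rewrite addSn => -[/IHn].
Qed.

Lemma removed_subset (k l : nat) : (k <= l)%N -> Z l `<=` A k.
Proof. by move=> kl rho [Al _]; exact: state_after_subset kl _ Al. Qed.

Lemma removed_before (n : nat) (rho : set (plane R)) :
  MIS T rho -> ~ A n rho -> exists2 k, (k < n)%N & Z k rho.
Proof.
move=> Trho; elim: n => [//|n IHn] nA.
have [An|/IHn[k kn Zk]] := pselect (A n rho); last by exists k => //; exact: ltnW.
by exists n => //; apply: contrapT => nZ; apply: nA.
Qed.

(** An entry listed before [rho] lies in the block of [rho] or in an earlier block, that is, in one
    of a pass at least [k]. Pass [k] itself does no harm, because its MISs are all still present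
    when it starts. *)
Lemma follows_reversed_history_before (iota : seq (set (plane R))) (k j : nat)
    (rho : set (plane R)) :
  follows_reversed_history T r m m' iota ->
  (k < pass_count T r m m')%N -> Z k rho -> (j < index rho iota)%N ->
  A k (nth set0 iota j).
Proof.
move=> [blocks -> E]; set N := pass_count T r m m' => kN Zk jlt.
have sizeE : size blocks = N.+1.
  by rewrite -(size_map (fun b => [set` b])) E size_rcons size_rev size_mkseq.
(* Passes are counted from 0 and listed backwards; block [N], the last one, is the CNDC. *)
have blockE i : (i < N)%N -> [set` nth [::] blocks i] = Z (N - i.+1).
  move=> iN; rewrite -(nth_map _ set0 (fun b => [set` b])); last first.
    by rewrite sizeE ltnS ltnW.
  rewrite E nth_rcons size_rev size_mkseq iN nth_rev size_mkseq //.
  by rewrite nth_mkseq // subnSK // leq_subr.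
pose i := (N - k.+1)%N.
have iN : (i < N)%N by rewrite /i subnSK // leq_subr.
(* The prefix ending with the block of pass [k]. It contains [rho], hence also every position before
   the first occurrence of [rho]. *)
pose s := flatten (take i.+1 blocks).
have splitE : flatten blocks = s ++ flatten (drop i.+1 blocks).
  by rewrite /s -flatten_cat cat_take_drop.
have rho_s : rho \in s.
  apply/flattenP; exists (nth [::] blocks i).
    rewrite -(nth_take (n0 := i.+1)) // mem_nth // size_take sizeE.
    by rewrite !ltnS ifT.
  suff : [set` nth [::] blocks i] rho by [].
  by rewrite blockE // /i subnSK // subKn // ltnW.
move: jlt; rewrite splitE index_cat rho_s => jlt.
have js : (j < size s)%N by rewrite (ltn_trans jlt) // index_mem.
rewrite nth_cat js.
have /flattenP[b /(nthP [::])[l]] := mem_nth set0 js.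
rewrite size_take sizeE !ltnS ifT // => li.
rewrite nth_take // => <- inb.
have lN : (l < N)%N by exact: leq_ltn_trans iN.
have : Z (N - l.+1) (nth set0 s j) by rewrite -blockE.
apply: removed_subset.
by move: li; rewrite /i ltnS !leq_subRL // addSnnS addnC.
Qed.

Lemma theta_le_omega (iota : seq (set (plane R))) (rho : set (plane R)) :
  is_tmesh T -> follows_reversed_history T r m m' iota ->
  MIS T rho -> ~ CNDC T r m m' rho ->
  theta m m' rho <= omega T r m m' iota rho.
Proof.
(* [CNDC] unfolds to the state after [pass_count] passes, so the pass removing [rho] is one of the
   recorded history. *)
move=> hT hrev Trho /(removed_before Trho)[k kN Zk].
have [_ /le_trans] := Zk; apply; rewrite /Omega /omega.
have Mono_Gamma : Mono T (state_after T r m m' k) rho `<=` Gamma T iota rho.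
  move=> x [Tx rhox xA]; split=> // j jlt; apply: xA; split.
    exact: follows_reversed_history_before hrev kN Zk jlt.
  (* [index] gives the first occurrence, so an earlier entry differs from [rho]. *)
  by move=> E; have := before_find set0 jlt; rewrite /= E eqxx.
(* A sum over a set defaults to 0 when its support is infinite; finiteness permits splitting off the
   part over [Mono], leaving a nonnegative rest. *)
have fin_Gamma : finite_set (Gamma T iota rho).
  by apply: sub_finite_set (vertices_finite hT) => x [].
rewrite [leRHS](fsbigID (Mono T (state_after T r m m' k) rho)) //.
rewrite (setIidr Mono_Gamma) lerDl.
by apply: fsumr_ge0 => x _; exact: mu_along_ge0.
Qed.

End DeletionHistory.

Theorem corollary3p24 (R : realType) (T : mesh R) (r : set (plane R) -> int)
    (m m' : nat) (hT : is_tmesh T) (hred : reduced T)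
    (hr : smoothness_distribution T r) (hconst : constant_along_MS T r)
    (iota : seq (set (plane R))) (hiota : MIS_order T iota)
    (hrev : follows_reversed_history T r m m' iota) :
  U_CNDC T r m m' iota = U_all T r m m' iota.
Proof.
rewrite /U_CNDC /U_all; congr (_ + _).
  (* Enlarging the index set is harmless once the terms outside the CNDC are zero. *)
  apply: fsbig_widen => [|rho [[Trho hrho] nC]]; first exact: subIsetr.
  have /(theta_le_omega hT hrev Trho) : ~ CNDC T r m m' rho by move=> C; apply: nC.
  rewrite /theta asboolT // => le_omega.
  by rewrite /preimage /= pos_part_eq0 ?mul0r // subr_le0.
apply: fsbig_widen => [|rho [[Trho vrho] nC]]; first exact: subIsetr.
have /(theta_le_omega hT hrev Trho) : ~ CNDC T r m m' rho by move=> C; apply: nC.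
rewrite /theta asboolF; last exact: vertical_not_horizontal.
by move=> le_omega; rewrite /preimage /= pos_part_eq0 ?mul0r // subr_le0.
Qed.
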